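(* For any integer $n\ge 0$, we have \[\mathrm{pod}(3n+2)\equiv 2(-1)^{n+1}r_{5}(8n+5) \pmod{9}.\]
   Context: For an integer $n\ge 0$, $\mathrm{pod}(n)$ denotes the number of partitions of $n$ in which the odd parts are distinct (even parts may repeat); equivalently $\sum_{n\ge 0}\mathrm{pod}(n)q^n=\prod_{i\ge 1}\frac{1+q^{2i-1}}{1-q^{2i}}$. For nonnegative integers $k,n$, $r_k(n)$ denotes the number of representations of $n$ as a sum of $k$ squares, i.e. the number of tuples $(x_1,\dots,x_k)\in\mathbb{Z}^k$ with $x_1^2+\cdots+x_k^2=n$ (order and signs count). *)

(* Defs.v *)
From mathcomp Require Import all_boot all_order all_algebra.
Set Implicit Arguments.
Unset Strict Implicit.
Unset Printing Implicit Defensive.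

Definition is_partition (n : nat) (s : seq nat) : bool :=
  [&& sorted geq s, 0 \notin s & sumn s == n].

Definition odd_parts_distinct (s : seq nat) : bool := uniq (filter odd s).

(* A partition of n has at most n parts, each at most n, so the bounded
   sequences over 'I_n.+1 of length at most n list every partition of n once. *)
Definition pod (n : nat) : nat :=
  #|[set s : n.-bseq 'I_n.+1 |
      is_partition n (map val s) && odd_parts_distinct (map val s)]|.

(* A solution of x_1^2 + ... + x_k^2 = n in integers has -n <= x_i <= n for
   every i; the index j : 'I_(n.*2.+1) encodes the integer j - n. *)
Definition r (k n : nat) : nat :=
  #|[set x : k.-tuple 'I_(n.*2.+1) |
      (\sum_(i < k) ((tnth x i)%:Z - n%:Z) ^+ 2 == n%:Z)%R]|.

(* Main.v *)
Require Import Defs.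
From mathcomp Require Import all_boot all_order all_algebra.
From mathcomp Require Import zify ring.
Set Implicit Arguments.
Unset Strict Implicit.
Unset Printing Implicit Defensive.
Import GRing.Theory.
Local Open Scope ring_scope.

(* Let psi = sum_s X^(s(s+1)/2).  By Gauss's product for psi, the series
   P = sum_n (-1)^n pod(n) X^n is 1/psi.  Splitting psi by exponents modulo 3,
   psi = a(X^3) + X psi(X^9), and norm3 psi = a^3 + X psi(X^3)^3 equals
   psi^4 / psi(X^3), so sum_n (-1)^n pod(3n+2) X^n = psi(X^3)^3 / psi^4, which
   is psi^5 modulo 9.  The coefficient t of X^n in psi^5 counts the ways to write
   n as a sum of five triangular numbers, that is, 8n+5 as a sum of five positive
   odd squares.  In a sum of five squares equal to 8n+5, either all terms are odd
   (32 t cases) or exactly one is; a halved Hadamard matrix applied to the four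
   even coordinates shows that each position of the odd one contributes 16 t
   cases.  So r_5(8n+5) = 112 t, and -2 * 112 = 1 modulo 9. *)

(** * Polynomials modulo [X^N] and Gauss's identity *)

Definition eqX (N : nat) (p q : {poly int}) : Prop :=
  forall i, (i < N)%N -> p`_i = q`_i.

Lemma eqX_refl N p : eqX N p p. Proof. by []. Qed.

Lemma eqX_sym N p q : eqX N p q -> eqX N q p.
Proof. by move=> h i /h. Qed.

Lemma eqX_trans N p q s : eqX N p q -> eqX N q s -> eqX N p s.
Proof. by move=> h1 h2 i lt_iN; rewrite h1 // h2. Qed.

Lemma eqX_le M N p q : (M <= N)%N -> eqX N p q -> eqX M p q.
Proof. by move=> le_MN h i lt_iM; apply: h; exact: leq_trans le_MN. Qed.

Lemma eqX_add N p1 q1 p2 q2 :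
  eqX N p1 q1 -> eqX N p2 q2 -> eqX N (p1 + p2) (q1 + q2).
Proof. by move=> h1 h2 i lt_iN; rewrite !coefD h1 // h2. Qed.

Lemma eqX_opp N p q : eqX N p q -> eqX N (- p) (- q).
Proof. by move=> h i lt_iN; rewrite !coefN h. Qed.

Lemma eqX_mul N p1 q1 p2 q2 :
  eqX N p1 q1 -> eqX N p2 q2 -> eqX N (p1 * p2) (q1 * q2).
Proof.
move=> h1 h2 i lt_iN; rewrite !coefM; apply: eq_bigr => j _.
by rewrite h1 ?h2 //; have := ltn_ord j; lia.
Qed.

Lemma eqX_exp N p q k : eqX N p q -> eqX N (p ^+ k) (q ^+ k).
Proof.
move=> h; elim: k => [|k IHk]; first exact: eqX_refl.
by rewrite !exprS; exact: eqX_mul.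
Qed.

Lemma eqX_sum0 N (I : Type) (s : seq I) (P : pred I) (F : I -> {poly int}) :
  (forall i, P i -> eqX N (F i) 0) -> eqX N (\sum_(i <- s | P i) F i) 0.
Proof.
move=> h; apply: (big_ind (fun p => eqX N p 0)) => //.
by move=> p q hp hq; rewrite -[0]addr0; exact: eqX_add.
Qed.

Lemma eqX_Xn N k : (N <= k)%N -> eqX N 'X^k 0.
Proof. by move=> le_Nk i lt_iN; rewrite coefXn coef0; case: eqP => // ?; lia. Qed.

(** Since [f] has constant term 1, coefficient i of [f * g] is that of [g] plus a combination of
    lower coefficients of [g], which agree with those of [h] by strong induction. *)
Lemma eqX_cancel N (f g h : {poly int}) : f`_0 = 1 -> eqX N (f * g) (f * h) -> eqX N g h.
Proof.
move=> f0 e; elim/ltn_ind => i IHi lt_iN.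
have := e i lt_iN; rewrite !coefM !big_ord_recl f0 !mul1r subn0.
have -> : \sum_(j < i) f`_(lift ord0 j) * g`_(i - lift ord0 j)
        = \sum_(j < i) f`_(lift ord0 j) * h`_(i - lift ord0 j).
  apply: eq_bigr => j _; have lt_ji := ltn_ord j.
  by rewrite IHi //; rewrite lift0; lia.
by move/addIr.
Qed.

Lemma coef0_prod (I : Type) (s : seq I) (P : pred I) (F : I -> {poly int}) :
  (forall i, P i -> (F i)`_0 = 1) -> (\prod_(i <- s | P i) F i)`_0 = 1.
Proof.
move=> h; apply: (big_ind (fun p : {poly int} => p`_0 = 1)) => //.
  by rewrite coefC.
by move=> p q hp hq; rewrite coef0M hp hq.
Qed.

Lemma coef0_exp (p : {poly int}) k : p`_0 = 1 -> (p ^+ k)`_0 = 1.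
Proof. by move=> h; elim: k => [|k IHk]; rewrite ?coef1 // exprS coef0M h IHk. Qed.

(** * Triangular numbers and Gauss's product for psi *)

Definition triangular (s : nat) : nat := 'C(s.+1, 2).

Lemma triangularS s : triangular s.+1 = (triangular s + s.+1)%N.
Proof. by rewrite /triangular binS bin1. Qed.

Lemma triangularE s : (2 * triangular s = s * s.+1)%N.
Proof. by elim: s => // s IHs; rewrite triangularS; lia. Qed.

Definition psi (K : nat) : {poly int} := \sum_(0 <= s < K) 'X^(triangular s).

Definition oddprod (m : nat) : {poly int} :=
  \prod_(0 <= i < m) (1 - 'X^(i.*2.+1)).

Definition evenprod (m : nat) : {poly int} :=
  \prod_(0 <= i < m) (1 - 'X^(i.*2.+2)).

Lemma coef0_oddprod m : (oddprod m)`_0 = 1.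
Proof. by apply: coef0_prod => i _; rewrite coefB coefXn coef1. Qed.

Lemma eqX_psi N K L : (N <= K)%N -> (N <= L)%N -> eqX N (psi K) (psi L).
Proof.
suff h M : (N <= M)%N -> eqX N (psi M) (psi N).
  by move=> /h hK /h hL; apply: eqX_trans hK _; exact: eqX_sym.
elim: M => [|M IHM]; first by rewrite leqn0 => /eqP ->.
rewrite leq_eqVlt => /orP[/eqP -> //|]; rewrite ltnS => le_NM.
rewrite /psi big_nat_recr //= -[X in eqX _ _ X]addr0.
apply: eqX_add; first exact: IHM.
by apply: eqX_Xn; have := triangularE M; nia.
Qed.

(* Shanks's finite form of Gauss's identity, with denominators cleared. *)
Definition shanks (n s : nat) : {poly int} :=
  oddprod s * \prod_(s <= i < n) (1 - 'X^(i.*2.+2)).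

Lemma shanks_recr n s : (s <= n)%N ->
  shanks n.+1 s = shanks n s * (1 - 'X^(n.*2.+2)).
Proof. by move=> le_sn; rewrite /shanks big_nat_recr // mulrA. Qed.

Lemma shanks_recl n s : (s < n)%N ->
  shanks n s.+1 * (1 - 'X^(s.*2.+2)) = shanks n s * (1 - 'X^(s.*2.+1)).
Proof.
move=> lt_sn; rewrite /shanks (@big_ltn _ _ _ s n) // /oddprod big_nat_recr //=.
by ring.
Qed.

(** In each summand the first term belongs to the sum of [shanks_sum] for n+1, the second to the one
    for n multiplied by 1 - X^(2n+1). The identity thus measures the change from n to n+1. *)
Lemma shanks_telescope n t : (t <= n)%N ->
  \sum_(0 <= s < t.+1)
     shanks n s * ('X^(s * n.*2.+3) * (1 - 'X^(n.*2.+2))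
                   - 'X^(s * n.*2.+1) * (1 - 'X^(n.*2.+1)))
  = shanks n t * 'X^(t.+1 * n.*2.+1) * (1 - 'X^(t.*2.+1)).
Proof.
elim: t => [_|t IHt lt_tn].
  by rewrite big_nat1 !mul0n double0 mul1n !expr0 (exprS _ n.*2.+1); ring.
rewrite big_nat_recr //= IHt ?(ltnW lt_tn) //.
(* The factor 1 - X^(2t+1) moves the index from t to t+1 and leaves 1 - X^(2t+2), so that both terms
   share [shanks n t.+1]. *)
rewrite [X in X + _]mulrAC -shanks_recl //.
have -> : (t.+1 * n.*2.+3 = t.+1 * n.*2.+1 + t.*2.+2)%N by lia.
have -> : (t.+2 * n.*2.+1 = t.+1 * n.*2.+1 + n.*2.+1)%N by lia.
have -> : t.+1.*2.+1 = (t.*2.+2).+1 by lia.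
rewrite !exprD (exprS _ n.*2.+1) (exprS _ t.*2.+2).
by ring.
Qed.

(** Induction on n: by telescoping, the sum for n+1 is 1 - X^(2n+1) times the sum for n enlarged by
    two monomials times [oddprod n]. Their exponents n(2n+1) and (n+1)(2n+1) are the triangular
    numbers of 2n and 2n+1, the next two in psi. *)
Lemma shanks_sum n :
  \sum_(0 <= s < n) shanks n s * 'X^(s * n.*2.+1) = oddprod n * psi n.*2.
Proof.
elim: n => [|n IHn]; first by rewrite /psi !big_geq // mulr0.
have shanks_nn : shanks n n = oddprod n by rewrite /shanks big_geq ?mulr1.
have := @shanks_telescope n n (leqnn n); rewrite shanks_nn.
have -> : \sum_(0 <= s < n.+1) shanks n.+1 s * 'X^(s * n.+1.*2.+1)
   = \sum_(0 <= s < n.+1) shanks n s * 'X^(s * n.*2.+3) * (1 - 'X^(n.*2.+2)).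
  rewrite !big_nat; apply: eq_bigr => s /andP[_ le_sn].
  by rewrite shanks_recr // mulrAC.
under eq_bigr do rewrite mulrBr !mulrA.
rewrite sumrB => /eqP; rewrite subr_eq => /eqP ->.
rewrite -mulr_suml big_nat_recr //= IHn shanks_nn.
rewrite /psi doubleS !big_nat_recr //= /oddprod big_nat_recr //=.
have -> : triangular n.*2 = (n * n.*2.+1)%N by have := triangularE n.*2; lia.
have -> : triangular n.*2.+1 = (n.+1 * n.*2.+1)%N
  by have := triangularE n.*2.+1; lia.
by ring.
Qed.

(** In [shanks_sum] the term s = 0 is [evenprod m], and every other term is divisible by
    X^(2m+1). *)
Lemma gauss m K : (m.*2 <= K)%N -> eqX m.*2 (oddprod m * psi K) (evenprod m).
Proof.
move=> le_mK; apply: (@eqX_trans _ _ (oddprod m * psi m.*2)).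
  by apply: eqX_mul; [exact: eqX_refl | exact: eqX_psi].
rewrite -shanks_sum; case: m le_mK => [//|m] le_mK.
rewrite big_ltn // mul0n mulr1 -[X in eqX _ _ X]addr0; apply: eqX_add.
  by rewrite /shanks /oddprod big_geq // mul1r; exact: eqX_refl.
rewrite big_nat; apply: eqX_sum0 => s /andP[s_gt0 _].
rewrite -(mulr0 (shanks m.+1 s)); apply: eqX_mul; first exact: eqX_refl.
by apply: eqX_Xn; nia.
Qed.

(** * Trisection *)

Definition trisect (i : nat) (f : {poly int}) : {poly int} :=
  \poly_(j < size f) f`_(3 * j + i)%N.

Definition tripoly (a b c : {poly int}) : {poly int} :=
  (a \Po 'X^3) + 'X * (b \Po 'X^3) + 'X^2 * (c \Po 'X^3).

Lemma coef_trisect i f j : (trisect i f)`_j = f`_(3 * j + i)%N.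
Proof.
rewrite coef_poly; case: ltnP => // le_fj.
by rewrite nth_default //; apply: leq_trans le_fj _; lia.
Qed.

Lemma trisect_tripoly a b c :
  [/\ trisect 0 (tripoly a b c) = a, trisect 1 (tripoly a b c) = b
    & trisect 2 (tripoly a b c) = c].
Proof.
split; apply/polyP => j; rewrite coef_trisect !coefD coefXM coefXnM;
  rewrite !coef_comp_poly_Xn //.
- have -> : (3 * j + 0 = 3 * j)%N by lia.
  rewrite dvdn_mulr // mulKn //.
  case: j => [|j]; first by rewrite muln0 /= !addr0.
  have -> : (3 %| (3 * j.+1).-1)%N = false by lia.
  have -> : (3 %| (3 * j.+1 - 2))%N = false by lia.
  by rewrite !if_same !addr0.
- have -> : (3 %| 3 * j + 1)%N = false by lia.
  have -> : (3 * j + 1 == 0)%N = false by lia.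
  have -> : ((3 * j + 1).-1 = 3 * j)%N by lia.
  rewrite dvdn_mulr // mulKn // add0r.
  case: j => [|j]; first by rewrite /= addr0.
  have -> : (3 %| (3 * j.+1 + 1 - 2))%N = false by lia.
  by rewrite if_same addr0.
- have -> : (3 %| 3 * j + 2)%N = false by lia.
  have -> : (3 * j + 2 == 0)%N = false by lia.
  have -> : (3 * j + 2 < 2)%N = false by lia.
  have -> : ((3 * j + 2).-1 = 3 * j + 1)%N by lia.
  have -> : (3 %| 3 * j + 1)%N = false by lia.
  by rewrite addnK dvdn_mulr // mulKn // !add0r.
Qed.

Lemma trisect2_tripoly a b c : trisect 2 (tripoly a b c) = c.
Proof. by have [] := trisect_tripoly a b c. Qed.

Lemma tripoly_trisect f : tripoly (trisect 0 f) (trisect 1 f) (trisect 2 f) = f.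
Proof.
apply/polyP => i.
have [t0 t1 t2] := trisect_tripoly (trisect 0 f) (trisect 1 f) (trisect 2 f).
have h k : (k < 3)%N -> trisect k (tripoly (trisect 0 f) (trisect 1 f) (trisect 2 f))
                    = trisect k f.
  by case: k => [|[|[|//]]] _.
have e : i = (3 * (i %/ 3) + i %% 3)%N by lia.
by rewrite e -!coef_trisect h // ltn_mod.
Qed.

Lemma comp_polyN (p q : {poly int}) : (- p) \Po q = - (p \Po q).
Proof. exact: raddfN. Qed.

Lemma comp_X3 : 'X \Po 'X^3 = 'X^3 :> {poly int}.
Proof. by rewrite comp_polyX. Qed.

Lemma tripolyM a b c a' b' c' :
  tripoly a b c * tripoly a' b' c' =
  tripoly (a * a' + 'X * (b * c' + c * b')) (a * b' + b * a' + 'X * (c * c'))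
          (a * c' + b * b' + c * a').
Proof. by rewrite /tripoly !comp_polyD !comp_polyM !comp_X3; ring. Qed.

(* The product of [f(X)], [f(wX)] and [f(w^2 X)], [w] a primitive cube root
   of unity, is [(norm3 f)(X^3)]. *)
Definition norm3 (f : {poly int}) : {poly int} :=
  trisect 0 f ^+ 3 + 'X * trisect 1 f ^+ 3 + 'X^2 * trisect 2 f ^+ 3
  - 3 *: ('X * trisect 0 f * trisect 1 f * trisect 2 f).

Lemma norm3_tripoly a b c : norm3 (tripoly a b c) =
  a ^+ 3 + 'X * b ^+ 3 + 'X^2 * c ^+ 3 - 3 *: ('X * a * b * c).
Proof. by rewrite /norm3; have [-> -> ->] := trisect_tripoly a b c. Qed.

(** [norm3 f] is the determinant of multiplication by f on the basis 1, X, X^2 over the polynomials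
    in X^3; in coordinates, multiplicativity is a polynomial identity. *)
Lemma norm3M f g : norm3 (f * g) = norm3 f * norm3 g.
Proof.
rewrite -(tripoly_trisect f) -(tripoly_trisect g) tripolyM !norm3_tripoly.
by rewrite -!mul_polyC; ring.
Qed.

(** For k prime to 3, the conjugates of 1 - X^k are 1 - w^j X^k for j = 0, 1, 2, with product 1 -
    X^(3k). *)
Lemma norm3_1subXn k : ~~ (3 %| k)%N -> norm3 (1 - 'X^k) = 1 - 'X^k.
Proof.
move=> nk; have : (k %% 3 = 1 \/ k %% 3 = 2)%N by lia.
have e : k = (3 * (k %/ 3) + k %% 3)%N by lia.
have c1 : (1 \Po 'X^3 : {poly int}) = 1 by rewrite comp_polyC.
case=> r; rewrite r in e; move: (k %/ 3)%N e => j ->.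
  have {1}-> : 1 - 'X^(3 * j + 1) = tripoly 1 (- 'X^j) 0.
    rewrite /tripoly comp_poly0 c1 comp_polyN comp_Xn_poly -exprM exprD expr1.
    by ring.
  by rewrite norm3_tripoly mulr0 scaler0 mulnC exprD exprM; ring.
have {1}-> : 1 - 'X^(3 * j + 2) = tripoly 1 0 (- 'X^j).
  rewrite /tripoly comp_poly0 c1 comp_polyN comp_Xn_poly -exprM exprD.
  by ring.
by rewrite norm3_tripoly mulr0 mul0r scaler0 mulnC exprD exprM; ring.
Qed.

Lemma norm3_comp f : norm3 (f \Po 'X^3) = f ^+ 3.
Proof.
have -> : f \Po 'X^3 = tripoly f 0 0 by rewrite /tripoly comp_poly0; ring.
by rewrite norm3_tripoly !mulr0 scaler0; ring.
Qed.

Lemma comp_1subXn k : (1 - 'X^k) \Po 'X^3 = 1 - 'X^(3 * k) :> {poly int}.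
Proof. by rewrite comp_polyB comp_polyC comp_Xn_poly -exprM. Qed.

(** The norm fixes the factors with exponent prime to 3 and turns 1 - X^(3j) into (1 - X^j)^3. Of
    the new exponents 6m+1, 6m+3, 6m+5, the middle one is a multiple of 3. *)
Lemma norm3_oddprod m :
  norm3 (oddprod (3 * m)) * (oddprod m \Po 'X^3) = oddprod (3 * m) * oddprod m ^+ 3.
Proof.
elim: m => [|m IHm].
  rewrite muln0 /oddprod big_geq // comp_polyC -[X in norm3 X](comp_polyC 1 'X^3).
  by rewrite norm3_comp; ring.
have -> : (3 * m.+1 = (3 * m).+3)%N by lia.
rewrite /oddprod !big_nat_recr //= -/(oddprod _) -/(oddprod _) !norm3M comp_polyM.
rewrite comp_1subXn.
have -> : (3 * m).+1.*2.+1 = (3 * m.*2.+1)%N by lia.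
rewrite -[in norm3 (1 - 'X^(3 * _))]comp_1subXn norm3_comp.
rewrite !norm3_1subXn; try lia.
move: IHm; set a := norm3 (oddprod _); set b := oddprod m \Po _ => IHm.
transitivity ((a * b) * (1 - 'X^((3 * m).*2.+1)) * (1 - 'X^(m.*2.+1)) ^+ 3
  * (1 - 'X^((3 * m).+2.*2.+1)) * (1 - 'X^(3 * m.*2.+1))); first by ring.
by rewrite IHm; ring.
Qed.

(** As for [oddprod]; of the new exponents 6m+2, 6m+4, 6m+6, the last is a multiple of 3. *)
Lemma norm3_evenprod m :
  norm3 (evenprod (3 * m)) * (evenprod m \Po 'X^3)
  = evenprod (3 * m) * evenprod m ^+ 3.
Proof.
elim: m => [|m IHm].
  rewrite muln0 /evenprod big_geq // comp_polyC -[X in norm3 X](comp_polyC 1 'X^3).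
  by rewrite norm3_comp; ring.
have -> : (3 * m.+1 = (3 * m).+3)%N by lia.
rewrite /evenprod !big_nat_recr //= -/(evenprod _) -/(evenprod _) !norm3M comp_polyM.
rewrite comp_1subXn.
have -> : (3 * m).+2.*2.+2 = (3 * m.*2.+2)%N by lia.
rewrite -[in norm3 (1 - 'X^(3 * _))]comp_1subXn norm3_comp.
rewrite !norm3_1subXn; try lia.
move: IHm; set a := norm3 (evenprod _); set b := evenprod m \Po _ => IHm.
transitivity ((a * b) * (1 - 'X^((3 * m).*2.+2)) * (1 - 'X^(m.*2.+2)) ^+ 3
  * (1 - 'X^((3 * m).+1.*2.+2)) * (1 - 'X^(3 * m.*2.+2))); first by ring.
by rewrite IHm; ring.
Qed.

Lemma eqX_trisect N i f g : (i < 3)%N -> eqX (3 * N) f g ->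
  eqX N (trisect i f) (trisect i g).
Proof. by move=> lt_i3 h j lt_jN; rewrite !coef_trisect h //; lia. Qed.

Lemma eqX_comp3 N f g : eqX N f g -> eqX (3 * N) (f \Po 'X^3) (g \Po 'X^3).
Proof.
by move=> h i lt_i; rewrite !coef_comp_poly_Xn //; case: ifP => // _; apply: h; lia.
Qed.

Lemma eqX_norm3 N f g : eqX (3 * N) f g -> eqX N (norm3 f) (norm3 g).
Proof.
move=> h; rewrite /norm3 -!mul_polyC.
by do ?[exact: eqX_refl | exact: eqX_trisect | apply: eqX_add | apply: eqX_opp
       | apply: eqX_exp | apply: eqX_mul].
Qed.

Lemma coef0_comp3 (f : {poly int}) : (f \Po 'X^3)`_0 = f`_0.
Proof. by rewrite coef_comp_poly_Xn. Qed.

(** Taking norms in psi = [evenprod] / [oddprod] gives norm3 psi = psi * psi^3 / psi(X^3). The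
    product [O * O' ^+ 3 * O3], of constant term 1, clears the denominators and is cancelled. *)
Lemma norm3_psi m K : (6 * m <= K)%N ->
  eqX m.*2 (norm3 (psi K) * (psi K \Po 'X^3)) (psi K ^+ 4).
Proof.
move=> le_mK.
pose O := oddprod (3 * m); pose O' := oddprod m; pose Q := evenprod (3 * m).
pose Q' := evenprod m; pose O3 := O' \Po 'X^3; pose Q3 := Q' \Po 'X^3.
have gQ : eqX m.*2 (O' * psi K) Q' by apply: gauss; lia.
have gQ3 : eqX m.*2 (O3 * (psi K \Po 'X^3)) Q3.
  rewrite -comp_polyM; apply: (@eqX_le _ (3 * m.*2)); first by lia.
  exact: eqX_comp3.
have gN : eqX m.*2 (norm3 O * norm3 (psi K)) (norm3 Q).
  rewrite -norm3M; apply: eqX_norm3.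
  have -> : (3 * m.*2 = (3 * m).*2)%N by lia.
  by apply: gauss; lia.
have gO : eqX m.*2 (O * psi K) Q.
  by apply: (@eqX_le _ (3 * m).*2); [lia | apply: gauss; lia].
apply: (@eqX_cancel _ (O * O' ^+ 3 * O3)).
  by rewrite 2!coef0M coef0_exp ?coef0_comp3 ?coef0_oddprod.
have -> : O * O' ^+ 3 * O3 * (norm3 (psi K) * (psi K \Po 'X^3))
   = (norm3 O * norm3 (psi K)) * (O3 * (psi K \Po 'X^3)) * O3.
  transitivity ((norm3 O * O3) * norm3 (psi K) * (psi K \Po 'X^3) * O3).
    by rewrite norm3_oddprod -/O -/O'; ring.
  by ring.
have -> : O * O' ^+ 3 * O3 * psi K ^+ 4 = (O * psi K) * (O' * psi K) ^+ 3 * O3.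
  by ring.
apply: eqX_mul; last exact: eqX_refl.
apply: (@eqX_trans _ _ (norm3 Q * Q3)); first exact: eqX_mul.
rewrite norm3_evenprod; apply: eqX_sym.
by apply: eqX_mul => //; apply: eqX_exp.
Qed.

(** The triangular numbers of 3s and 3s+2 are multiples of 3 and go into [a]; that of 3s+1 is 9
    times that of s, plus 1. *)
Lemma trisect_psi m :
  exists a, psi (3 * m) = tripoly a (psi m \Po 'X^3) 0.
Proof.
elim: m => [|m [a IHm]].
  by exists 0; rewrite /psi muln0 big_geq // /tripoly !comp_poly0; ring.
exists (a + 'X^(triangular (3 * m) %/ 3) + 'X^(triangular (3 * m).+2 %/ 3)).
have -> : (3 * m.+1 = (3 * m).+3)%N by lia.
have t0 := triangularE (3 * m); have t1 := triangularE (3 * m).+1.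
have t2 := triangularE (3 * m).+2; have t := triangularE m.
rewrite /psi !big_nat_recr //= -/(psi _) -/(psi _) IHm /tripoly !comp_polyD.
rewrite !comp_Xn_poly -!exprM !comp_Xn_poly -!exprM.
have -> : (3 * (triangular (3 * m) %/ 3) = triangular (3 * m))%N by nia.
have -> : (3 * (triangular (3 * m).+2 %/ 3) = triangular (3 * m).+2)%N by nia.
have -> : triangular (3 * m).+1 = (3 * (3 * triangular m)).+1 by nia.
have -> : (3 * (3 * triangular m) = 3 * 3 * triangular m)%N by lia.
by move: (3 * 3 * triangular m)%N => k; rewrite (exprS _ k); ring.
Qed.

(** Cubing is additive modulo 3; adding a monomial x to p costs the correction 3px(p + x). *)
Lemma psi_cube K : exists h, psi K \Po 'X^3 = psi K ^+ 3 + 3%:R * h.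
Proof.
elim: K => [|K [h IHK]].
  by exists 0; rewrite /psi big_geq // comp_poly0; ring.
exists (h - psi K * 'X^(triangular K) * (psi K + 'X^(triangular K))).
rewrite /psi big_nat_recr //= -/(psi _) comp_polyD IHK comp_Xn_poly -exprM mulnC.
by rewrite exprM; ring.
Qed.

(* With P = 1/psi the 3-dissection of psi gives
   P_2 = psi(X^3)^2 / norm3 psi = psi(X^3)^3 / psi^4, and psi(X^3)^3 is
   congruent to psi^9 modulo 9. *)
Lemma trisect_inv_psi m (P : {poly int}) :
  eqX (6 * m) (P * psi (6 * m)) 1 ->
  exists h, eqX m.*2 (trisect 2 P) (psi (6 * m) ^+ 5 + 9%:R * h).
Proof.
set f := psi (6 * m); move=> Pf.
have [a fE] : exists a, f = tripoly a (psi m.*2 \Po 'X^3) 0.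
  rewrite /f (_ : 6 * m = 3 * m.*2)%N; last by lia.
  exact: trisect_psi.
set b := psi m.*2 \Po 'X^3 in fE.
have hb : eqX m.*2 b (f \Po 'X^3).
  apply: (@eqX_le _ (3 * m.*2)); first by lia.
  by apply: eqX_comp3; apply: eqX_psi; lia.
(* With A = a(X^3) and B = b(X^3), f = A + XB and the norm at X^3 is A^3 + X^3 B^3. The right-hand
   side is the cofactor A^2 - XAB + X^2 B^2, which remains since P inverts f. *)
have h1 : eqX (6 * m) (P * (norm3 f \Po 'X^3)) (tripoly (a ^+ 2) (- (a * b)) (b ^+ 2)).
  have -> : norm3 f \Po 'X^3 = f * tripoly (a ^+ 2) (- (a * b)) (b ^+ 2).
    rewrite {2}fE tripolyM fE norm3_tripoly mulr0 scaler0 /tripoly.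
    rewrite !comp_polyD !comp_polyM !comp_polyN !comp_poly0 !comp_polyM !comp_X3.
    by ring.
  by rewrite mulrA -[X in eqX _ _ X]mul1r; apply: eqX_mul.
(* Multiplication by a polynomial in X^3 acts on each third separately, so the third of index 2 can
   be read off from [h1]. *)
have h2 : eqX m.*2 (trisect 2 P * norm3 f) (b ^+ 2).
  have -> : trisect 2 P * norm3 f = trisect 2 (P * (norm3 f \Po 'X^3)).
    have -> : norm3 f \Po 'X^3 = tripoly (norm3 f) 0 0.
      by rewrite /tripoly comp_poly0; ring.
    rewrite -{2}(tripoly_trisect P) tripolyM.
    by rewrite trisect2_tripoly; ring.
  rewrite -(trisect2_tripoly (a ^+ 2) (- (a * b)) (b ^+ 2)).
  by apply: eqX_trisect => //; have -> : (3 * m.*2 = 6 * m)%N by lia.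
have [h hE] := psi_cube (6 * m); rewrite -/f in hE.
have h3 : eqX m.*2 (trisect 2 P * f ^+ 4) ((f \Po 'X^3) ^+ 3).
  apply: (@eqX_trans _ _ (trisect 2 P * norm3 f * (f \Po 'X^3))).
    rewrite -mulrA; apply: eqX_mul; first exact: eqX_refl.
    by apply: eqX_sym; apply: norm3_psi; exact: leqnn.
  rewrite (exprSr (f \Po 'X^3) 2); apply: eqX_mul; last exact: eqX_refl.
  by apply: eqX_trans h2 _; exact: eqX_exp.
have Pf' : eqX m.*2 (P * f) 1 by apply: eqX_le Pf; lia.
(* The witness collects the multiples of 9 in P^4 (f^3 + 3h)^3; the leading term P^4 f^9 is f^5
   because P f is 1. *)
exists (P ^+ 4 * (f ^+ 6 * h + 3%:R * f ^+ 3 * h ^+ 2 + 3%:R * h ^+ 3)).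
apply: (@eqX_trans _ _ (trisect 2 P * (P * f) ^+ 4)).
  rewrite -{1}[trisect 2 P]mulr1; apply: eqX_mul; first exact: eqX_refl.
  by rewrite -(expr1n _ 4); apply: eqX_exp; exact: eqX_sym.
apply: (@eqX_trans _ _ (P ^+ 4 * (f \Po 'X^3) ^+ 3)).
  by rewrite exprMn mulrCA; apply: eqX_mul.
rewrite hE.
have -> : P ^+ 4 * (f ^+ 3 + 3%:R * h) ^+ 3 = (P * f) ^+ 4 * f ^+ 5
  + 9%:R * (P ^+ 4 * (f ^+ 6 * h + 3%:R * f ^+ 3 * h ^+ 2 + 3%:R * h ^+ 3)).
  by ring.
apply: eqX_add; last exact: eqX_refl.
rewrite -[X in eqX _ _ X]mul1r; apply: eqX_mul; last exact: eqX_refl.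
by rewrite -(expr1n _ 4); apply: eqX_exp.
Qed.

(** * Counting partitions *)

(** Cardinality for predicates on infinite types, witnessed by a duplicate-free enumeration;
    bijections can then ignore the bounds built into [pod] and [r]. *)
Definition counts (T : eqType) (P : pred T) (k : nat) : Prop :=
  exists2 l : seq T, uniq l /\ l =i P & size l = k.

Lemma counts_inj (T : eqType) (P : pred T) k k' :
  counts P k -> counts P k' -> k = k'.
Proof.
move=> [l [ul lP] <-] [l' [ul' lP'] <-]; apply/perm_size.
by apply: uniq_perm => // x; rewrite lP lP'.
Qed.

Lemma counts_bij (T U : eqType) (P : pred T) (Q : pred U) f g k :
  (forall x, P x -> Q (f x) /\ g (f x) = x) ->
  (forall y, Q y -> P (g y) /\ f (g y) = y) -> counts P k -> counts Q k.
Proof.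
move=> hf hg [l [ul lP] <-]; exists (map f l); last by rewrite size_map.
split=> [|y].
  rewrite map_inj_in_uniq // => x y; rewrite !lP => /hf[_ ex] /hf[_ ey] e.
  by rewrite -ex -ey e.
apply/mapP/idP => [[x + ->]|/hg[Pgy <-]]; first by rewrite lP => /hf[].
by exists (g y); rewrite ?lP // (hg _ Qy).2.
Qed.

Lemma eq_counts (T : eqType) (P Q : pred T) k : P =1 Q -> counts P k -> counts Q k.
Proof.
move=> e [l [ul lP] <-]; exists l => //; split=> // x.
by rewrite lP; exact: e.
Qed.

Lemma counts_sub (T : eqType) (P Q : pred T) k :
  counts P k -> exists k', counts (predI P Q) k'.
Proof.
move=> [l [ul lP] _]; exists (size (filter Q l)), (filter Q l) => //.
by split=> [|x]; rewrite ?filter_uniq // mem_filter lP andbC.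
Qed.

Lemma counts_split (T : eqType) (Q P : pred T) a b :
  counts (predI P Q) a -> counts (predI P (predC Q)) b -> counts P (a + b).
Proof.
move=> [l [ul lP] <-] [l' [ul' lP'] <-]; exists (l ++ l'); last by rewrite size_cat.
split=> [|x].
  rewrite cat_uniq ul ul' andbT /=; apply/hasPn => x; rewrite lP' => /andP[_ nQ].
  by rewrite /= lP; apply: contra nQ => /andP[].
by rewrite mem_cat lP lP' !inE /= -andb_orr orbN andbT.
Qed.

Lemma counts_pred0 (T : eqType) (P : pred T) : P =1 pred0 -> counts P 0.
Proof. by move=> e; exists nil => //; split=> // x; exact/esym/e. Qed.

Lemma counts_double (T : eqType) (P Q : pred T) f k :
  involutive f -> (forall x, P x -> P (f x) /\ Q (f x) = ~~ Q x) ->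
  counts (predI P Q) k -> counts P k.*2.
Proof.
move=> fK hf h; rewrite -addnn; apply: (@counts_split _ Q) => //.
apply: (@counts_bij _ _ _ _ f f _ _ _) h => x /andP[/= Px Qx]; have [Pfx e] := hf x Px;
  by rewrite fK /= Pfx e Qx.
Qed.

Lemma counts_card (T : finType) (U : eqType) (A : {pred T}) (P : pred U) (g : T -> U) :
  injective g -> (forall t, t \in A = P (g t)) ->
  (forall u, P u -> exists t, g t = u) -> counts P #|A|.
Proof.
move=> gI gP Pg; exists (map g (enum A)); last by rewrite size_map -cardE.
split=> [|u]; first by rewrite map_inj_uniq // enum_uniq.
apply/mapP/idP => [[t + ->]|Pu]; first by rewrite mem_enum gP.
by have [t e] := Pg u Pu; exists t; rewrite // mem_enum gP e.
Qed.

(** * The generating function of pod, by bounding the largest part *)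

Definition pod_part (m n : nat) (s : seq nat) : bool :=
  [&& is_partition n s, odd_parts_distinct s & all (geq m) s].

Definition pod_upto (m n : nat) : nat :=
  #|[set s : n.-bseq 'I_n.+1 | pod_part m n (map val s)]|.

Lemma size_le_sumn s : (0 \notin s)%N -> (size s <= sumn s)%N.
Proof.
elim: s => //= x s IHs; rewrite inE negb_or => /andP[x0 /IHs].
by move: x0; lia.
Qed.

Lemma le_sumn x s : x \in s -> (x <= sumn s)%N.
Proof.
elim: s => //= y s IHs; rewrite inE => /orP[/eqP ->|/IHs]; first exact: leq_addr.
by lia.
Qed.

Lemma counts_pod_upto m n : counts (pod_part m n) (pod_upto m n).
Proof.
apply: (@counts_card _ _ _ _ (fun s : n.-bseq 'I_n.+1 => map val s)).
- by move=> s t /(inj_map val_inj) e; apply: val_inj.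
- by move=> s; rewrite inE.
move=> s /and3P[/and3P[_ s0 /eqP sn] _ _].
have le_sn : (size (map (@inord n) s) <= n)%N.
  by rewrite size_map -sn size_le_sumn.
exists (Bseq le_sn); rewrite /= -map_comp -[RHS]map_id; apply/eq_in_map => x sx.
by rewrite /= inordK // ltnS -sn le_sumn.
Qed.

Lemma pod_uptoE m n : (n <= m)%N -> pod_upto m n = pod n.
Proof.
move=> le_nm; apply: eq_card => s; rewrite !inE /pod_part.
case: (boolP (is_partition _ _)) => //= /and3P[_ _ /eqP sn].
case: odd_parts_distinct => //=; apply/allP => x /le_sumn.
by rewrite sn => h; apply: leq_trans le_nm.
Qed.

Lemma pod_upto0 n : pod_upto 0 n = (n == 0)%N.
Proof.
apply: counts_inj (counts_pod_upto 0 n) _.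
have h s : pod_part 0 n s -> s = [::] /\ n = 0%N.
  case: s => [/and3P[/and3P[_ _ /eqP <-]]//|x s].
  case/and3P=> /and3P[_ + _] _ /=; rewrite inE negb_or => /andP[x0 _].
  by case/andP=> /=; move: x0; lia.
case: n h => [|n] h; last by apply: counts_pred0 => s; apply/negP => /h[].
exists [:: [::]] => //; split=> // s; rewrite inE.
by apply/eqP/idP => [->|/h[]].
Qed.

Lemma geq_transitive : transitive geq.
Proof. by move=> y x z /= yx zy; exact: leq_trans zy yx. Qed.

(** After a part m+1 is removed, the bound stays m+1 if that part is even, since it may repeat, and
    drops to m if it is odd. *)
Lemma pod_part_cons m n s : pod_part m.+1 n (m.+1 :: s) =
  (m.+1 <= n)%N && pod_part (if odd m then m.+1 else m) (n - m.+1) s.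
Proof.
rewrite /pod_part /is_partition /odd_parts_distinct /=.
rewrite (path_sortedE geq_transitive).
rewrite inE negb_or /= leqnn /=.
have -> : (m.+1 + sumn s == n) = (m.+1 <= n)%N && (sumn s == n - m.+1)%N by lia.
case: (m < n)%N => /=; last by rewrite !andbF.
have allSS : all (geq m) s -> all (geq m.+1) s.
  by apply: sub_all => x /= h; apply: leq_trans h _.
have allS : m.+1 \notin s -> all (geq m.+1) s -> all (geq m) s.
  move=> ms /allP h; apply/allP => x sx /=.
  rewrite -ltnS ltn_neqAle [(_ <= _)%N](h x sx).
  by rewrite andbT; apply: contraNneq ms => <-.
case: (boolP (odd m)) => /= om.
  by case: all; rewrite ?andbF ?andbT.
rewrite mem_filter /= om /=.
case: (boolP (all (geq m) s)) => am.
  rewrite (allSS am) /=.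
  have -> : m.+1 \notin s by apply/negP => /(allP am) /=; rewrite ltnn.
  by rewrite !andbT.
rewrite !andbF; case: (boolP (m.+1 \in s)) => ms; rewrite ?andbF //.
by case: (boolP (all (geq m.+1) s)) => // /(allS ms); rewrite (negbTE am).
Qed.

(** The parts decrease, so the head alone decides whether m+1 occurs; the default 0 for the empty
    partition differs from m+1. *)
Lemma pod_part_head m n s :
  pod_part m.+1 n s && (head 0 s != m.+1)%N = pod_part m n s.
Proof.
rewrite /pod_part /is_partition; case: s => [|x s] /=.
  by rewrite andbT.
rewrite (path_sortedE geq_transitive).
case: (boolP (all (geq x) s)) => [ax|]; last by rewrite /= ?andbF.
have h k : (x <= k)%N -> all (geq k) s.
  by move=> xk; apply: sub_all ax => y /= yx; apply: leq_trans xk.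
rewrite -!andbA; do 5!congr (_ && _).
apply/idP/idP => [/and3P[xm _ nx]|/andP[xm _]].
  have xm' : (x <= m)%N by lia.
  by rewrite xm' h.
by rewrite h ?(leqW xm) //=; lia.
Qed.

Lemma pod_uptoS m n : pod_upto m.+1 n =
  (pod_upto m n + if (m.+1 <= n)%N
                  then pod_upto (if odd m then m.+1 else m) (n - m.+1) else 0)%N.
Proof.
apply: counts_inj (counts_pod_upto _ _) _; rewrite addnC.
apply: (@counts_split _ (fun s => head 0%N s == m.+1)); last first.
  by apply: eq_counts (counts_pod_upto m n) => s; rewrite /= pod_part_head.
set m' := if odd m then _ else _; case: ltnP => [lt_mn|le_nm].
  apply: (@counts_bij _ _ _ _ (cons m.+1) behead _ _ _) (counts_pod_upto m' (n - m.+1)).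
    by move=> s hs /=; rewrite eqxx andbT pod_part_cons lt_mn.
  case=> [|x s] /andP[+ /eqP //= e]; rewrite -[in X in X -> _]e.
  by move: e => /= ->; rewrite pod_part_cons => /andP[].
apply: counts_pred0 => -[|x s] /=; first by rewrite andbF.
apply/negP => /andP[+ /eqP e]; rewrite e pod_part_cons.
by rewrite ltnNge le_nm.
Qed.

(** The sign substitutes -X for the variable, turning the factors 1 + q^(2i-1) into those of
    [oddprod] and keeping the even ones. *)
Definition podpoly (N m : nat) : {poly int} :=
  \poly_(n < N) ((-1) ^+ n * (pod_upto m n)%:Z).

Lemma podpolyS N m : eqX N (podpoly N m.+1)
  (podpoly N m + (-1) ^+ m.+1 *: ('X^(m.+1) * podpoly N (if odd m then m.+1 else m))).
Proof.
move=> i lt_iN; rewrite coefD coefZ coefXnM !coef_poly lt_iN pod_uptoS.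
case: (ltnP m i) => [lt_mi|le_im]; last first.
  by rewrite ltnS le_im mulr0 addr0 addn0.
rewrite ltnS leqNgt lt_mi /= (leq_ltn_trans (leq_subr _ _) lt_iN).
by rewrite PoszD mulrDr mulrA -exprD subnKC.
Qed.

(** Allowing the part 2m+1, at most once, multiplies by 1 - X^(2m+1); allowing 2m+2, any number of
    times, divides by 1 - X^(2m+2). *)
Lemma podpoly_evenprod N m :
  eqX N (podpoly N m.*2 * evenprod m) (oddprod m).
Proof.
elim: m => [|m IHm].
  rewrite /evenprod /oddprod !big_geq // mulr1 => i lt_iN.
  by rewrite coef_poly lt_iN coef1 pod_upto0; case: i lt_iN => //= i _; rewrite mulr0.
rewrite doubleS /evenprod /oddprod !big_nat_recr //= -/(evenprod _) -/(oddprod _).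
have h1 := @podpolyS N m.*2; have h2 := @podpolyS N m.*2.+1.
rewrite /= !odd_double /= in h1 h2.
have e1 : (-1) ^+ m.*2.+1 = -1 :> int by rewrite exprS -mul2n exprM sqrrN !expr1n mulr1.
have e2 : (-1) ^+ m.*2.+2 = 1 :> int by rewrite exprS e1.
rewrite e1 scaleN1r in h1; rewrite e2 scale1r in h2.
have h3 : eqX N (podpoly N m.*2.+2 * (1 - 'X^(m.*2.+2))) (podpoly N m.*2.+1).
  have -> : podpoly N m.*2.+2 * (1 - 'X^(m.*2.+2))
     = podpoly N m.*2.+2 + - ('X^(m.*2.+2) * podpoly N m.*2.+2) by ring.
  have -> : podpoly N m.*2.+1 = podpoly N m.*2.+1 + 'X^(m.*2.+2) * podpoly N m.*2.+2
      + - ('X^(m.*2.+2) * podpoly N m.*2.+2) by ring.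
  by apply: eqX_add.
have -> : podpoly N m.*2.+2 * (evenprod m * (1 - 'X^(m.*2.+2)))
   = podpoly N m.*2.+2 * (1 - 'X^(m.*2.+2)) * evenprod m by ring.
apply: (@eqX_trans _ _ (podpoly N m.*2.+1 * evenprod m)); first exact: eqX_mul.
apply: (@eqX_trans _ _ (podpoly N m.*2 * (1 - 'X^(m.*2.+1)) * evenprod m)).
  apply: eqX_mul => //; apply: eqX_trans h1 _.
  by rewrite mulrBr mulr1 (mulrC 'X^_).
by rewrite mulrAC; apply: eqX_mul.
Qed.

Lemma podpoly_psi m : eqX m.*2 (podpoly m.*2 m.*2 * psi m.*2) 1.
Proof.
apply: (@eqX_cancel _ (oddprod m)); first exact: coef0_oddprod.
rewrite mulrCA mulr1.
apply: (@eqX_trans _ _ (podpoly m.*2 m.*2 * evenprod m)); last exact: podpoly_evenprod.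
by apply: eqX_mul => //; exact: gauss.
Qed.

(** * Sums of five squares *)

Definition five_triangles (n : nat) (k : nat * nat * nat * nat * nat) : bool :=
  let: (a, b, c, d, e) := k in
  (triangular a + triangular b + triangular c + triangular d + triangular e == n)%N.

Definition five_squares (n : nat) (x : int * int * int * int * int) : bool :=
  let: (a, b, c, d, e) := x in a * a + b * b + c * c + d * d + e * e == n%:Z.

(** The fifth power expands into a sum over functions from ['I_5] to ['I_K]. Since x is at most
    [triangular x], n < K ensures that no solution is cut off. *)
Lemma counts_five_triangles K n : (n < K)%N ->
  exists2 t, counts (five_triangles n) t & (psi K ^+ 5)`_n = t%:Z.
Proof.
move=> lt_nK.
pose A := [pred f : {ffun 'I_5 -> 'I_K} | \sum_i triangular (f i) == n]%N.
pose o k (h : (k < 5)%N) := Ordinal h.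
pose g (f : {ffun 'I_5 -> 'I_K}) : nat * nat * nat * nat * nat :=
  (f (o 0%N isT) : nat, f (o 1%N isT) : nat, f (o 2%N isT) : nat, f (o 3%N isT) : nat,
   f (o 4%N isT) : nat).
have I5 (i : 'I_5) : [\/ i = o 0%N isT, i = o 1%N isT, i = o 2%N isT | i = o 3%N isT \/ i = o 4%N isT].
  case: i => [[|[|[|[|[|//]]]]] h];
   [constructor 1|constructor 2|constructor 3|constructor 4; left|constructor 4; right];
   exact: val_inj.
exists #|A|.
  apply: (@counts_card _ _ A _ g).
  - move=> f f' [e0 e1 e2 e3 e4]; apply/ffunP => i; apply: val_inj.
    by case: (I5 i) => [->|->|->|[->|->]].
  - move=> f; rewrite inE /g /= !big_ord_recr big_ord0 /= add0n.
    by congr (_ + _ + _ + _ + _ == _)%N; congr (triangular (f _)); apply: val_inj.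
  move=> [[[[a b] c] d] e] /= /eqP h.
  have lt_K x : (triangular x <= n)%N -> (x < K)%N.
    by have := triangularE x; nia.
  have ha : (a < K)%N by apply: lt_K; lia.
  have hb : (b < K)%N by apply: lt_K; lia.
  have hc : (c < K)%N by apply: lt_K; lia.
  have hd : (d < K)%N by apply: lt_K; lia.
  have he : (e < K)%N by apply: lt_K; lia.
  exists [ffun i : 'I_5 => nth (Ordinal ha)
    [:: Ordinal ha; Ordinal hb; Ordinal hc; Ordinal hd; Ordinal he] i].
  by rewrite /g !ffunE.
have -> : psi K ^+ 5 = \prod_(i < 5) \sum_(s < K) 'X^(triangular s).
  by rewrite prodr_const card_ord /psi big_mkord.
rewrite bigA_distr_bigA /= coef_sum -[RHS]natz -sum1_card natr_sum [RHS]big_mkcond /=.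
apply: eq_bigr => f _; rewrite prodrXr coefXn inE eq_sym.
by case: eqP.
Qed.

Lemma counts_five_squares K : counts (five_squares K) (r 5 K).
Proof.
pose co (t : 5.-tuple 'I_(K.*2.+1)) k : int := (nth ord0 t k)%:Z - K%:Z.
apply: (@counts_card _ _ _ _ (fun t => (co t 0%N, co t 1%N, co t 2%N, co t 3%N, co t 4%N))).
- move=> [[|a [|b [|c [|d [|e [|]]]]]] //= h] [[|a' [|b' [|c' [|d' [|e' [|]]]]]] //= h'].
  rewrite /co /= => -[e0 e1 e2 e3 e4]; apply: val_inj => /=.
  by congr [:: _; _; _; _; _]; apply: val_inj => /=; lia.
- move=> t; rewrite inE /= !big_ord_recr big_ord0 /= add0r !(tnth_nth ord0) /= !expr2.
  by [].
move=> [[[[a b] c] d] e] /= /eqP h.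
have bound (x : int) : x * x <= K%:Z -> - K%:Z <= x <= K%:Z by nia.
have sq0 (x : int) : 0 <= x * x by nia.
have [a0 b0 c0 d0 e0] : [/\ 0 <= a * a, 0 <= b * b, 0 <= c * c, 0 <= d * d & 0 <= e * e].
  by split.
have inK (x : int) : x * x <= K%:Z -> (@inord K.*2 (absz (x + K%:Z)))%:Z - K%:Z = x.
  by move=> /bound hx; rewrite inordK; lia.
exists [tuple inord (absz (a + K%:Z)); inord (absz (b + K%:Z)); inord (absz (c + K%:Z));
        inord (absz (d + K%:Z)); inord (absz (e + K%:Z))].
by rewrite /co /= !inK //; lia.
Qed.

(** * Parity classes of the representations of 8n+5 *)

Definition oddz (x : int) : bool := odd (absz x).

Lemma oddzP x : exists k : int, x = 2 * k + (oddz x : nat)%:Z.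
Proof. by exists (x %/ 2)%Z; rewrite /oddz; lia. Qed.

Lemma sqr_oddz x : exists k : int, x * x = 4 * k + (oddz x : nat)%:Z.
Proof.
have [k] := oddzP x; move: (oddz x) => o ->.
by exists (k * k + k * (o : nat)%:Z); case: o => /=; ring.
Qed.

Lemma pronic_even (x : int) : exists k, x * (x + 1) = 2 * k.
Proof.
have [j] := oddzP x; case: (oddz x) => /= ->; last by exists (j * (2 * j + 1)); ring.
by exists ((2 * j + 1) * (j + 1)); ring.
Qed.

Lemma oddzN x : oddz (- x) = oddz x.
Proof. by rewrite /oddz abszN. Qed.

Lemma oddzD x y : oddz (x + y) = oddz x (+) oddz y.
Proof. by rewrite /oddz; lia. Qed.

Definition all_odd (x : int * int * int * int * int) : bool :=
  let: (a, b, c, d, e) := x in [&& oddz a, oddz b, oddz c, oddz d & oddz e].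

Definition first_odd (x : int * int * int * int * int) : bool :=
  let: (a, b, c, d, e) := x in
  [&& oddz a, ~~ oddz b, ~~ oddz c, ~~ oddz d & ~~ oddz e].

(** Squares are 0 or 1 modulo 4, so the number of odd coordinates is 1 modulo 4, hence 1 or 5. *)
Lemma one_odd n a b c d e :
  five_squares (8 * n + 5) (a, b, c, d, e) ->
  ~~ all_odd (a, b, c, d, e) ->
  (oddz a + oddz b + oddz c + oddz d + oddz e = 1)%N.
Proof.
rewrite /= => /eqP h.
have [ka ea] := sqr_oddz a; have [kb eb] := sqr_oddz b.
have [kc ec] := sqr_oddz c; have [kd ed] := sqr_oddz d.
have [ke ee] := sqr_oddz e.
move: h; rewrite ea eb ec ed ee.
by case: (oddz a); case: (oddz b); case: (oddz c); case: (oddz d); case: (oddz e)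
  => //=; lia.
Qed.

(* Half of a symmetric 4x4 Hadamard matrix acting on the last four coordinates:
   where the divisions are exact it is an involution preserving the sum of
   squares, and it exchanges even vectors of odd half-sum with odd vectors of sum
   divisible by 4. *)
Definition hadamard (x : int * int * int * int * int) :=
  let: (a, b, c, d, e) := x in
  (a, ((b + c + d + e) %/ 2)%Z, ((b + c - d - e) %/ 2)%Z,
      ((b - c + d - e) %/ 2)%Z, ((b - c - d + e) %/ 2)%Z).

Definition sum4 (x : int * int * int * int * int) : bool :=
  let: (a, b, c, d, e) := x in (4 %| b + c + d + e)%Z.

Lemma hadamardP a b c d e : (2 %| b + c + d + e)%Z ->
  exists h1 h2 h3 h4 : int,
  [/\ hadamard (a, b, c, d, e) = (a, h1, h2, h3, h4),
      b + c + d + e = 2 * h1, b + c - d - e = 2 * h2, b - c + d - e = 2 * h3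
    & b - c - d + e = 2 * h4].
Proof.
move=> h; exists ((b + c + d + e) %/ 2)%Z, ((b + c - d - e) %/ 2)%Z,
  ((b - c + d - e) %/ 2)%Z, ((b - c - d + e) %/ 2)%Z.
by split=> //; lia.
Qed.

Lemma hadamard_sumsq (b c d e h1 h2 h3 h4 : int) :
  b + c + d + e = 2 * h1 -> b + c - d - e = 2 * h2 -> b - c + d - e = 2 * h3 ->
  b - c - d + e = 2 * h4 ->
  h1 * h1 + h2 * h2 + h3 * h3 + h4 * h4 = b * b + c * c + d * d + e * e.
Proof.
move=> e1 e2 e3 e4.
have : 4 * (h1 * h1 + h2 * h2 + h3 * h3 + h4 * h4) =
  (2 * h1) * (2 * h1) + (2 * h2) * (2 * h2) + (2 * h3) * (2 * h3) + (2 * h4) * (2 * h4).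
  by ring.
by rewrite -e1 -e2 -e3 -e4; lia.
Qed.

Lemma hadamard_first_odd n x :
  five_squares (8 * n + 5) x && first_odd x ->
  [&& five_squares (8 * n + 5) (hadamard x), all_odd (hadamard x) & sum4 (hadamard x)]
  /\ hadamard (hadamard x) = x.
Proof.
move: x => [[[[a b] c] d] e] /andP[/eqP hs /and5P[oa ob oc od oe]].
have [ka ea] := oddzP a; have [kb eb] := oddzP b.
have [kc ec] := oddzP c; have [kd ed] := oddzP d.
have [ke ee] := oddzP e.
rewrite oa (negbTE ob) (negbTE oc) (negbTE od) (negbTE oe) /= in ea eb ec ed ee.
have [|h1 [h2 [h3 [h4 [-> e1 e2 e3 e4]]]]] := @hadamardP a b c d e; first by lia.
have [|g1 [g2 [g3 [g4 [-> f1 f2 f3 f4]]]]] := @hadamardP a h1 h2 h3 h4; first by lia.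
have [eg1 eg2 eg3 eg4] : [/\ g1 = b, g2 = c, g3 = d & g4 = e] by split; lia.
split; last by rewrite eg1 eg2 eg3 eg4.
have hs' : a * a + h1 * h1 + h2 * h2 + h3 * h3 + h4 * h4 = (8 * n + 5)%N%:Z.
  by have := hadamard_sumsq e1 e2 e3 e4; rewrite -hs; lia.
have [k hk] := pronic_even ka.
have [jb sb] := sqr_oddz kb; have [jc sc] := sqr_oddz kc.
have [jd sd] := sqr_oddz kd; have [je se] := sqr_oddz ke.
(* As a is odd, a^2 = 8k + 1; dividing the remaining even squares by 4 shows that the squares of the
   halves have the odd sum 2n + 1 - 2k. *)
have par : oddz (kb + kc + kd + ke).
  have s1 : kb * kb + kc * kc + kd * kd + ke * ke = 2 * n%:Z + 1 - 2 * k.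
    have ea2 : a * a = 8 * k + 1 by rewrite ea; move: hk; clear; lia.
    have eb2 : b * b = 4 * (kb * kb) by rewrite eb; ring.
    have ec2 : c * c = 4 * (kc * kc) by rewrite ec; ring.
    have ed2 : d * d = 4 * (kd * kd) by rewrite ed; ring.
    have ee2 : e * e = 4 * (ke * ke) by rewrite ee; ring.
    by move: hs; rewrite ea2 eb2 ec2 ed2 ee2; clear; lia.
  move: s1; rewrite !oddzD sb sc sd se; clear.
  by case: (oddz kb); case: (oddz kc); case: (oddz kd); case: (oddz ke) => //=; lia.
rewrite /= hs' eqxx oa /=.
(* All four images have the parity of the odd number kb + kc + kd + ke, and they add up to 4 kb. *)
have [-> -> -> ->] : [/\ h1 = kb + kc + kd + ke, h2 = kb + kc - kd - ke,
    h3 = kb - kc + kd - ke & h4 = kb - kc - kd + ke].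
  by move: e1 e2 e3 e4; rewrite eb ec ed ee; clear; split; lia.
rewrite !oddzD in par; rewrite !oddzD !oddzN !par /=.
by clear; lia.
Qed.

Lemma hadamard_all_odd n x :
  [&& five_squares (8 * n + 5) x, all_odd x & sum4 x] ->
  five_squares (8 * n + 5) (hadamard x) && first_odd (hadamard x)
  /\ hadamard (hadamard x) = x.
Proof.
move: x => [[[[a b] c] d] e] /and3P[/eqP hs /and5P[oa ob oc od oe] h4].
rewrite /sum4 in h4.
have [|h1 [h2 [h3 [h5 [-> e1 e2 e3 e4]]]]] := @hadamardP a b c d e; first by lia.
have [|g1 [g2 [g3 [g4 [-> f1 f2 f3 f4]]]]] := @hadamardP a h1 h2 h3 h5; first by lia.
have [eg1 eg2 eg3 eg4] : [/\ g1 = b, g2 = c, g3 = d & g4 = e] by split; lia.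
split; last by rewrite eg1 eg2 eg3 eg4.
have hs' : a * a + h1 * h1 + h2 * h2 + h3 * h3 + h5 * h5 = (8 * n + 5)%N%:Z.
  by have := hadamard_sumsq e1 e2 e3 e4; rewrite -hs; lia.
rewrite /= hs' eqxx oa /=.
(* The first image is even because 4 divides the sum; it differs from the others by d + e, c + e and
   c + d, all even. *)
by clear -h4 ob oc od oe e1 e2 e3 e4; rewrite /oddz in ob oc od oe *;
  apply/and4P; split; lia.
Qed.

Lemma counts_neg (T : eqType) (P : pred T) (f : T -> T) (x : T -> int) k :
  involutive f -> (forall t, P t -> P (f t) /\ x (f t) = - x t /\ x t != 0) ->
  counts (predI P (fun t => 0 < x t)) k -> counts P k.*2.
Proof.
move=> fK h; apply: (@counts_double _ _ _ f) => // t /h[Pft [-> x0]].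
by split=> //; lia.
Qed.

(** Each of the five sign changes doubles the count, as odd coordinates are nonzero. A positive odd
    2k+1 has square 8 T + 1, with T the triangular number of k. *)
Lemma counts_all_odd n t : counts (five_triangles n) t ->
  counts (predI (five_squares (8 * n + 5)) all_odd) (32 * t).
Proof.
move=> ht; have -> : (32 * t = t.*2.*2.*2.*2.*2)%N by lia.
have nz x : oddz x -> x != 0 by rewrite /oddz; lia.
pose f1 (x : int * int * int * int * int) := let: (a, b, c, d, e) := x in (- a, b, c, d, e).
pose f2 (x : int * int * int * int * int) := let: (a, b, c, d, e) := x in (a, - b, c, d, e).
pose f3 (x : int * int * int * int * int) := let: (a, b, c, d, e) := x in (a, b, - c, d, e).
pose f4 (x : int * int * int * int * int) := let: (a, b, c, d, e) := x in (a, b, c, - d, e).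
pose f5 (x : int * int * int * int * int) := let: (a, b, c, d, e) := x in (a, b, c, d, - e).
apply: (@counts_neg _ _ f1 (fun x => x.1.1.1.1)).
- by move=> [[[[a b] c] d] e]; rewrite /f1 opprK.
- move=> [[[[a b] c] d] e] /=; rewrite mulrNN oddzN => h.
  by rewrite h nz //; case/and5P: (andP h).2.
apply: (@counts_neg _ _ f2 (fun x => x.1.1.1.2)).
- by move=> [[[[a b] c] d] e]; rewrite /f2 opprK.
- move=> [[[[a b] c] d] e] /=; rewrite mulrNN oddzN => h.
  by rewrite h nz //; case/and5P: (andP (andP h).1).2.
apply: (@counts_neg _ _ f3 (fun x => x.1.1.2)).
- by move=> [[[[a b] c] d] e]; rewrite /f3 opprK.
- move=> [[[[a b] c] d] e] /=; rewrite mulrNN oddzN => h.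
  by rewrite h nz //; case/and5P: (andP (andP (andP h).1).1).2.
apply: (@counts_neg _ _ f4 (fun x => x.1.2)).
- by move=> [[[[a b] c] d] e]; rewrite /f4 opprK.
- move=> [[[[a b] c] d] e] /=; rewrite mulrNN oddzN => h.
  by rewrite h nz //; case/and5P: (andP (andP (andP (andP h).1).1).1).2.
apply: (@counts_neg _ _ f5 (fun x => x.2)).
- by move=> [[[[a b] c] d] e]; rewrite /f5 opprK.
- move=> [[[[a b] c] d] e] /=; rewrite mulrNN oddzN => h.
  by rewrite h nz //; case/and5P: (andP (andP (andP (andP (andP h).1).1).1).1).2.
pose up (k : nat) : int := (k.*2.+1)%:Z.
pose dn (x : int) : nat := (absz x)./2.
have upK k : dn (up k) = k by rewrite /up /dn; lia.
have dnK x : oddz x -> 0 < x -> up (dn x) = x by rewrite /oddz /up /dn; lia.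
have upT k : up k * up k = 8 * (triangular k)%:Z + 1.
  by have := triangularE k; rewrite /up; nia.
have up_odd k : oddz (up k) by rewrite /oddz /up; lia.
have up_gt0 k : 0 < up k by rewrite /up; lia.
clearbody up dn.
apply: (@counts_bij _ _ _ _
  (fun k : nat * nat * nat * nat * nat => let: (a, b, c, d, e) := k in
     (up a, up b, up c, up d, up e))
  (fun x : int * int * int * int * int => let: (a, b, c, d, e) := x in
     (dn a, dn b, dn c, dn d, dn e)) _ _ _ ht).
- move=> [[[[a b] c] d] e] /= /eqP h; rewrite !upK !upT !up_odd !up_gt0 !andbT; split=> //.
  by apply/eqP; lia.
move=> [[[[a b] c] d] e] /= /andP[/andP[/andP[/andP[/andP[]]]]].
move=> /andP[/eqP hs /and5P[oa ob oc od oe]] pa pb pc pd pe.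
rewrite !dnK //; split=> //; apply/eqP.
by rewrite -(dnK a) // -(dnK b) // -(dnK c) // -(dnK d) // -(dnK e) // !upT in hs; lia.
Qed.

Lemma counts_swap n k f (Q : pred (int * int * int * int * int)) :
  involutive f -> (forall x, five_squares n (f x) = five_squares n x) ->
  (forall x, five_squares n x -> first_odd (f x) = Q x) ->
  counts (predI (five_squares n) first_odd) k ->
  counts (predI (five_squares n) Q) k.
Proof.
move=> fK hf hQ; apply: (@counts_bij _ _ _ _ f f) => x /andP[/= sx].
  by move=> ox; rewrite hf sx fK -hQ ?hf // fK.
by rewrite -hQ // hf sx fK => ->.
Qed.

Lemma r5_triangles n t :
  counts (five_triangles n) t -> r 5 (8 * n + 5) = (112 * t)%N.
Proof.
move=> ht; set S := five_squares (8 * n + 5).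
have hodd : counts (predI S all_odd) (32 * t) := counts_all_odd ht.
have [b hb] := counts_sub sum4 hodd.
(* Negating one odd coordinate changes the even sum of the last four by 2 modulo 4, so [sum4] holds
   for exactly half of the all-odd solutions. *)
have bE : (32 * t = b.*2)%N.
  apply: counts_inj hodd _.
  pose f (x : int * int * int * int * int) := let: (a, b, c, d, e) := x in (a, - b, c, d, e).
  apply: (@counts_double _ _ sum4 f) => //.
    by move=> [[[[a b'] c] d] e]; rewrite /f opprK.
  move=> [[[[a b'] c] d] e] /=; rewrite mulrNN oddzN /oddz => h; split=> //.
  by case/and5P: (andP h).2; lia.
have hfirst : counts (predI S first_odd) b.
  apply: (@counts_bij _ _ _ _ hadamard hadamard) hb => x /=.
    by rewrite -andbA; exact: hadamard_all_odd.
  by rewrite -andbA; exact: hadamard_first_odd.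
apply: counts_inj (counts_five_squares _) _.
(* The five copies of b = 16t are the possible positions of the single odd coordinate; the last four
   reduce to the first by a transposition. *)
have -> : (112 * t = 32 * t + (b + (b + (b + (b + b)))))%N by lia.
apply: (@counts_split _ all_odd) => //.
pose o1 (x : int * int * int * int * int) := oddz x.1.1.1.1.
pose o2 (x : int * int * int * int * int) := oddz x.1.1.1.2.
pose o3 (x : int * int * int * int * int) := oddz x.1.1.2.
pose o4 (x : int * int * int * int * int) := oddz x.1.2.
have swap f Q R : involutive f -> (forall x, S (f x) = S x) ->
    (forall x, S x -> first_odd (f x) = Q x) ->
    predI S Q =1 R -> counts R b.
  by move=> fK hf hQ eR; apply: eq_counts eR _; apply: counts_swap hfirst.
apply: (@counts_split _ o1).
  apply: eq_counts hfirst => -[[[[a b'] c] d] e].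
  move: (@one_odd n a b' c d e); rewrite /S /= /o1 /=; case: (_ == _) => //= /(_ isT).
  by case: oddz; case: oddz; case: oddz; case: oddz; case: oddz; move=> //= /(_ isT).
apply: (@counts_split _ o2).
  apply: (@swap (fun x => let: (a, b, c, d, e) := x in (b, a, c, d, e))
                (fun x => let: (a, b, c, d, e) := x in first_odd (b, a, c, d, e))).
  - by move=> [[[[a b'] c] d] e].
  - by move=> [[[[a b'] c] d] e]; rewrite /S /=; congr (_ == _); ring.
  - by move=> [[[[a b'] c] d] e].
  move=> [[[[a b'] c] d] e].
  move: (@one_odd n a b' c d e); rewrite /S /= /o1 /o2 /=; case: (_ == _) => //= /(_ isT).
  by case: oddz; case: oddz; case: oddz; case: oddz; case: oddz; move=> //= /(_ isT).
apply: (@counts_split _ o3).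
  apply: (@swap (fun x => let: (a, b, c, d, e) := x in (c, b, a, d, e))
                (fun x => let: (a, b, c, d, e) := x in first_odd (c, b, a, d, e))).
  - by move=> [[[[a b'] c] d] e].
  - by move=> [[[[a b'] c] d] e]; rewrite /S /=; congr (_ == _); ring.
  - by move=> [[[[a b'] c] d] e].
  move=> [[[[a b'] c] d] e].
  move: (@one_odd n a b' c d e); rewrite /S /= /o1 /o2 /o3 /=; case: (_ == _) => //= /(_ isT).
  by case: oddz; case: oddz; case: oddz; case: oddz; case: oddz; move=> //= /(_ isT).
apply: (@counts_split _ o4).
  apply: (@swap (fun x => let: (a, b, c, d, e) := x in (d, b, c, a, e))
                (fun x => let: (a, b, c, d, e) := x in first_odd (d, b, c, a, e))).
  - by move=> [[[[a b'] c] d] e].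
  - by move=> [[[[a b'] c] d] e]; rewrite /S /=; congr (_ == _); ring.
  - by move=> [[[[a b'] c] d] e].
  move=> [[[[a b'] c] d] e].
  move: (@one_odd n a b' c d e); rewrite /S /= /o1 /o2 /o3 /o4 /=; case: (_ == _) => //= /(_ isT).
  by case: oddz; case: oddz; case: oddz; case: oddz; case: oddz; move=> //= /(_ isT).
apply: (@swap (fun x => let: (a, b, c, d, e) := x in (e, b, c, d, a))
              (fun x => let: (a, b, c, d, e) := x in first_odd (e, b, c, d, a))).
- by move=> [[[[a b'] c] d] e].
- by move=> [[[[a b'] c] d] e]; rewrite /S /=; congr (_ == _); ring.
- by move=> [[[[a b'] c] d] e].
move=> [[[[a b'] c] d] e].
move: (@one_odd n a b' c d e); rewrite /S /= /o1 /o2 /o3 /o4 /=; case: (_ == _) => //= /(_ isT).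
by case: oddz; case: oddz; case: oddz; case: oddz; case: oddz; move=> //= /(_ isT).
Qed.

(** * Comparison of the coefficients of X^n modulo 9 *)

Theorem theorem1 (n : nat) :
  ((pod (3 * n + 2))%:Z
     = 2%:Z * (-1) ^+ (n + 1) * (r 5 (8 * n + 5))%:Z %[mod 9%:Z])%Z%R.
Proof.
(* This precision suffices: n < 2m for the coefficient of the third, and 3n + 2 < 6m for that of
   [podpoly]. *)
pose m := n.+1.
have [t ht tE] := @counts_five_triangles (6 * m) n ltac:(lia).
have [h hE] : exists h, eqX m.*2 (trisect 2 (podpoly (6 * m) (6 * m)))
                          (psi (6 * m) ^+ 5 + 9%:R * h).
  apply: trisect_inv_psi; have -> : (6 * m = (3 * m).*2)%N by lia.
  exact: podpoly_psi.
have := hE n ltac:(lia).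
rewrite coef_trisect coef_poly ifT; last by lia.
rewrite pod_uptoE; last by lia.
rewrite coefD tE mulr_natl coefMn -mulr_natr (r5_triangles ht).
have -> : (-1) ^+ (3 * n + 2) = (-1) ^+ n :> int.
  by rewrite -signr_odd -[RHS]signr_odd; congr (_ ^+ _); lia.
rewrite addn1 exprS -signr_odd.
(* By [e], (-1)^n pod(3n+2) is t plus a multiple of 9, and -2 * 112 = 1 - 9 * 25. *)
move=> e; apply/eqP; rewrite eqz_mod_dvd; move: e.
by case: odd; rewrite /= ?expr0 ?expr1; lia.
Qed.
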